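(* Let $G$ be a graph with $\gamma_R(G)=\frac{3}{2}\gamma_{r2}(G)$, and let $f$ be a $2$-rainbow dominating function of $G$ of weight $\gamma_{r2}(G)$. For $F\in 2^{\{1,2\}}$ let $V_F=f^{-1}(F)$ and $n_F=|V_F|$. Then: (i) $n_{\{1\}}=n_{\{2\}}$ and $n_{\{1,2\}}=0$; (ii) there are no edges between $V_{\{1\}}$ and $V_{\{2\}}$; (iii) for $i\in\{1,2\}$, the maximum degree of the induced subgraph $G[V_{\{i\}}]$ is at most $1$; (iv) for $i\in\{1,2\}$, every vertex in $V_{\emptyset}$ has at least $1$ and at most $2$ neighbors in $V_{\{i\}}$; (v) for $i\in\{1,2\}$, every vertex $u\in V_{\{i\}}$ has at least $2$ neighbors $v\in V_{\emptyset}$ with $N_G(v)\cap V_{\{i\}}=\{u\}$.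
   Context: All graphs are finite, simple and undirected; $N_G(v)$ denotes the set of neighbors of $v$ in $G$. A $2$-rainbow dominating function of a graph $G$ is a function $f:V(G)\to 2^{\{1,2\}}$ such that $\bigcup_{v\in N_G(u)} f(v)=\{1,2\}$ for every vertex $u$ with $f(u)=\emptyset$; its weight is $\sum_{u\in V(G)}|f(u)|$, and $\gamma_{r2}(G)$ is the minimum weight of a $2$-rainbow dominating function of $G$. A Roman dominating function of $G$ is a function $g:V(G)\to\{0,1,2\}$ such that every vertex $u$ with $g(u)=0$ has a neighbor $v$ with $g(v)=2$; its weight is $\sum_{u\in V(G)} g(u)$, and $\gamma_R(G)$ is the minimum weight of a Roman dominating function of $G$. *)

(* Defs.v *)
From mathcomp Require Import all_boot all_order all_algebra.

Set Implicit Arguments.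
Unset Strict Implicit.
Unset Printing Implicit Defensive.

(* A finite simple graph is a symmetric irreflexive [e : rel T] on a
   [T : finType]; both properties are hypotheses wherever they are needed. *)
Section Graphs.
Variables (T : finType) (e : rel T).

Definition nbhd (u : T) : {set T} := [set v | e u v].

Definition max_degree : nat := \max_(u : T) #|nbhd u|.

End Graphs.

Definition induced (T : finType) (e : rel T) (S : {set T}) :
  rel {x : T | x \in S} := fun x y => e (val x) (val y).

(* The colours 1 and 2 are the two elements of ['I_2], so that {1,2} is
   [[set: 'I_2]]. *)
Definition colour1 : 'I_2 := ord0.
Definition colour2 : 'I_2 := ord_max.

Section Domination.
Variables (T : finType) (e : rel T).

Implicit Types (f : {ffun T -> {set 'I_2}}) (g : {ffun T -> 'I_3}).

Definition rainbow_dominating f : bool :=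
  [forall u, (f u == set0) ==> (\bigcup_(v in nbhd e u) f v == [set: 'I_2])].

Definition rainbow_weight f : nat := \sum_(u : T) #|f u|.

Definition colour_class f (F : {set 'I_2}) : {set T} := [set u | f u == F].

Definition roman_dominating g : bool :=
  [forall u, (g u == 0 :> nat) ==> [exists v in nbhd e u, g v == 2 :> nat]].

Definition roman_weight g : nat := \sum_(u : T) (g u : nat).

(* The constant functions {1,2} and 2 are always dominating, so both minima
   range over nonempty sets; see [gamma_r2P] and [gamma_RP]. *)
Definition gamma_r2 : nat :=
  rainbow_weight
    [arg min_(f < [ffun=> setT] | rainbow_dominating f) rainbow_weight f].

Definition gamma_R : nat :=
  roman_weight
    [arg min_(g < [ffun=> ord_max] | roman_dominating g) roman_weight g].

Lemma gamma_r2P :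
  (exists2 f, rainbow_dominating f & rainbow_weight f = gamma_r2) /\
  (forall f, rainbow_dominating f -> gamma_r2 <= rainbow_weight f).
Proof.
rewrite /gamma_r2; case: arg_minnP => [|f Df minf].
  apply/forallP=> u; rewrite ffunE; apply/implyP=> /eqP/setP/(_ ord0).
  by rewrite !inE.
by split=> //; exists f.
Qed.

Lemma gamma_RP :
  (exists2 g, roman_dominating g & roman_weight g = gamma_R) /\
  (forall g, roman_dominating g -> gamma_R <= roman_weight g).
Proof.
rewrite /gamma_R; case: arg_minnP => [|g Dg ming].
  by apply/forallP=> u; rewrite ffunE.
by split=> //; exists g.
Qed.

End Domination.

(* Main.v *)
(** A Roman dominating function is a pair (X, Y), X carrying the value 2 and Y
    the value 1, such that every other vertex has a neighbour in X.  If A_i is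
    the set of vertices whose label contains i, then (A_1, A_2 minus A_1) and
    (A_2, A_1 minus A_2) are such pairs, and their weights add up to
    [3 * gamma_r2 e - 2 * #|A_1 :&: A_2|].  Under the hypothesis A_1 and A_2 are
    therefore disjoint, of equal size, and both pairs are optimal; each of
    (ii)-(v) holds because its failure allows a local change that lowers the
    weight of one of the two pairs. *)
Require Import Defs.
From mathcomp Require Import all_boot all_order all_algebra.
From mathcomp Require Import zify ring.

Set Implicit Arguments.
Unset Strict Implicit.
Unset Printing Implicit Defensive.

Definition roman_pair (T : finType) (e : rel T) (X Y : {set T}) : Prop :=
  forall v, v \notin X -> v \notin Y -> exists2 w, e v w & w \in X.

(** [X] and [Y] may overlap: a common vertex gets the value 2 but counts 3 on the right, which only
    weakens the bound. *)
Lemma gamma_R_le_pair (T : finType) (e : rel T) (X Y : {set T}) :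
  roman_pair e X Y -> gamma_R e <= 2 * #|X| + #|Y|.
Proof.
move=> XY.
pose g : {ffun T -> 'I_3} :=
  [ffun u => inord (if u \in X then 2 else (u \in Y : nat))].
have gE u : g u = (if u \in X then 2 else (u \in Y : nat)) :> nat.
  by rewrite ffunE inordK //; case: ifP => // _; case: (u \in Y).
have Dg : roman_dominating e g.
  apply/forallP=> v; rewrite gE; apply/implyP.
  case: ifPn => // vX; rewrite eqb0 => vY.
  have [w evw wX] := XY v vX vY.
  by apply/existsP; exists w; rewrite inE evw gE wX.
apply: leq_trans ((gamma_RP e).2 g Dg) _.
rewrite -!sum1_card [in leqRHS]big_mkcond [\sum_(i in Y) 1]big_mkcond /=.
rewrite big_distrr -big_split /=; apply: leq_sum => u _.
by rewrite gE; case: (u \in X); case: (u \in Y).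
Qed.

Section OptimalPair.
Variables (T : finType) (e : rel T) (A B : {set T}).
Hypotheses (e_sym : symmetric e) (pairAB : roman_pair e A B)
  (pairBA : roman_pair e B A) (cardAB : #|A| = #|B|)
  (gamma_ge : 3 * #|A| <= gamma_R e).

Lemma optimal_pair_nonadjacent u w : u \in A -> w \in B -> ~~ e u w.
Proof.
move=> uA wB; apply/negP=> euw.
suff /gamma_R_le_pair : roman_pair e A (B :\ w).
  by have := cardsD1 w B; rewrite wB; lia.
move=> v vA; rewrite !inE negb_and negbK => /orP[/eqP->|vB].
  by exists u; rewrite // e_sym.
exact: pairAB.
Qed.

(** Putting [u] into [B] costs at most 2 and lets every vertex of [A] in the closed neighbourhood of
    [u] be dropped. Taking [u] in [A] serves (iii), taking it outside both sets serves (iv). *)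
Lemma optimal_pair_closed_nbhd u : #|A :&: (u |: nbhd e u)| <= 2.
Proof.
suff /gamma_R_le_pair : roman_pair e (u |: B) (A :\: (u |: nbhd e u)).
  have := cardsID (u |: nbhd e u) A; have := cardsU1 u B.
  by case: (u \notin B); lia.
move=> v; rewrite !inE negb_or => /andP[/negPf-> vB] /=.
rewrite negb_and negbK => /orP[euv|vA].
  by exists u; rewrite ?setU11 // e_sym.
by have [w evw wB] := pairBA vB vA; exists w; rewrite // setU1r.
Qed.

Lemma optimal_pair_private_nbhd u : u \in A ->
  2 <= #|[set v in nbhd e u :\: (A :|: B) | nbhd e v :&: A == [set u]]|.
Proof.
move=> uA; set P := [set v in _ | _].
have cardA : #|A| = #|A :\ u|.+1 by rewrite (cardsD1 u A) uA.
(* Vertices outside [P] do not rely on [u] alone, so they stay dominated when [u] leaves [A]. *)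
have other v : v \notin A -> v \notin B -> v \notin P ->
    exists2 w, e v w & w \in A :\ u.
  move=> vA vB vP; have [w evw wA] := pairAB vA vB.
  have [wu|wNu] := eqVneq w u; last by exists w; rewrite // !inE wNu.
  rewrite {w}wu in evw wA.
  have : nbhd e v :&: A != [set u].
    by move: vP; rewrite !inE (negPf vA) (negPf vB) e_sym evw.
  rewrite eqEsubset sub1set !inE evw uA !andbT => /subsetPn[w].
  by rewrite !inE => /andP[evw' wA'] wNu; exists w; rewrite // !inE wNu.
rewrite leqNgt ltnS leq_eqVlt ltnS leqn0; apply/negP=> /orP[|].
  case/cards1P=> p defP.
  have : p \in P by rewrite defP set11.
  rewrite !inE negb_or => /andP[/andP[/andP[pA pB] eup] _].
  have [w epw wB] := pairBA pB pA.
  suff /gamma_R_le_pair : roman_pair e (p |: A :\ u) (B :\ w).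
    have := cardsD1 w B; have := cardsU1 p (A :\ u); rewrite wB.
    by case: (p \notin _); lia.
  move=> v; rewrite !inE negb_or !negb_and !negbK => /andP[vp vAu] vBw.
  have [->|vNu] := eqVneq v u; first by exists p; rewrite // setU11.
  have [->|vNw] := eqVneq v w; first by exists p; rewrite ?setU11 // e_sym.
  rewrite (negPf vNu) (negPf vNw) /= in vAu vBw.
  have [|x evx xA] := other v vAu vBw; first by rewrite defP inE.
  by exists x; rewrite // setU1r.
(* No private neighbour: lowering the value of [u] from 2 to 1 saves 1. *)
rewrite cards_eq0 => /eqP P0.
suff /gamma_R_le_pair : roman_pair e (A :\ u) (u |: B).
  by have := cardsU1 u B; case: (u \notin B); lia.
move=> v; rewrite !inE negb_and negb_or negbK => vAu /andP[vNu vB].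
by rewrite (negPf vNu) /= in vAu; apply: other; rewrite // P0 inE.
Qed.

End OptimalPair.

Lemma colourP (i : 'I_2) : i = colour1 \/ i = colour2.
Proof. by case: i => [[|[|//]] lti]; [left | right]; apply: val_inj. Qed.

Definition colour_support (T : finType) (f : {ffun T -> {set 'I_2}})
  (i : 'I_2) : {set T} := [set u | i \in f u].

Section Support.
Variables (T : finType) (e : rel T) (f : {ffun T -> {set 'I_2}}).

Lemma rainbow_weight_support :
  rainbow_weight f =
  #|colour_support f colour1| + #|colour_support f colour2|.
Proof.
rewrite -!sum1_card big_mkcond [X in _ + X]big_mkcond -big_split /=.
apply: eq_bigr => u _; rewrite -sum1_card big_mkcond /= !inE.
by rewrite big_ord_recl big_ord1 (_ : lift _ _ = colour2) //; apply: val_inj.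
Qed.

Lemma notin_colour_support i j u : i != j ->
  u \notin colour_support f i -> u \notin colour_support f j -> f u = set0.
Proof.
rewrite !inE => ij iu ju; apply/setP=> k; rewrite inE; apply: negbTE.
by move: ij iu ju; case: (colourP i) => ->; case: (colourP j) => ->;
  case: (colourP k) => ->.
Qed.

(** A vertex outside both supports has the empty label, so it sees colour [i] on some neighbour. *)
Lemma colour_support_roman_pair i j : i != j -> rainbow_dominating e f ->
  roman_pair e (colour_support f i) (colour_support f j :\: colour_support f i).
Proof.
move=> ij /forallP f_dom v vi; rewrite in_setD vi /= => vj.
have /implyP := f_dom v; rewrite (notin_colour_support ij vi vj) eqxx.
move=> /(_ isT)/eqP/setP/(_ i); rewrite inE => /bigcupP[w].
by rewrite inE => evw iw; exists w; rewrite // inE.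
Qed.

Hypothesis disj :
  colour_support f colour1 :&: colour_support f colour2 = set0.

Lemma colour_class_support i : colour_class f [set i] = colour_support f i.
Proof.
apply/setP=> u; rewrite !inE; apply/eqP/idP=> [->|iu]; first exact: set11.
apply/setP=> k; rewrite inE; have := congr1 (fun S : {set T} => u \in S) disj.
rewrite !inE; move: iu; case: (colourP i) => ->; case: (colourP k) => ->;
  by move=> ->; rewrite ?andbT.
Qed.

Lemma colour_class_setT : colour_class f setT = set0.
Proof.
apply/setP=> u; rewrite !inE; apply/negP=> /eqP fu.
have := congr1 (fun S : {set T} => u \in S) disj.
by rewrite !inE fu !inE.
Qed.

Lemma colour_class_set0 i j : i != j ->
  colour_class f set0 = ~: (colour_support f i :|: colour_support f j).
Proof.
move=> ij; apply/setP=> u; rewrite in_setC in_setU negb_or !inE.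
apply/eqP/idP=> [->|/andP[iu ju]]; first by rewrite !inE.
by apply: (notin_colour_support ij); rewrite inE.
Qed.

End Support.

Lemma max_degree_induced (T : finType) (e : rel T) (S : {set T}) k :
  (forall u, u \in S -> #|S :&: nbhd e u| <= k) ->
  max_degree (induced e (S := S)) <= k.
Proof.
move=> leS; apply/bigmax_leqP => -[u uS] _; apply: leq_trans (leS u uS).
rewrite -(card_imset _ val_inj); apply/subset_leq_card/subsetP=> x.
by case/imsetP=> -[y yS]; rewrite !inE => euy ->; rewrite yS.
Qed.

Theorem theorem6 (T : finType) (e : rel T)
    (e_sym : symmetric e) (e_irr : irreflexive e)
    (gammaE : ((gamma_R e)%:R = 3 / 2 * (gamma_r2 e)%:R :> rat)%R)
    (f : {ffun T -> {set 'I_2}})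
    (f_dom : rainbow_dominating e f)
    (f_min : rainbow_weight f = gamma_r2 e) :
  (* (i) *)
  (#|colour_class f [set colour1]| = #|colour_class f [set colour2]| /\
   #|colour_class f [set: 'I_2]| = 0) /\
  (* (ii) *)
  (forall u w : T, u \in colour_class f [set colour1] ->
     w \in colour_class f [set colour2] -> ~~ e u w) /\
  (* (iii) *)
  (forall i : 'I_2,
     max_degree (induced e (S := colour_class f [set i])) <= 1) /\
  (* (iv) *)
  (forall (i : 'I_2) (u : T), u \in colour_class f set0 ->
     1 <= #|nbhd e u :&: colour_class f [set i]| <= 2) /\
  (* (v) *)
  (forall (i : 'I_2) (u : T), u \in colour_class f [set i] ->
     2 <= #|[set v in nbhd e u :&: colour_class f set0 |
             nbhd e v :&: colour_class f [set i] == [set u]]|).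
Proof.
have c12 : colour1 != colour2 by [].
have c21 : colour2 != colour1 by [].
have gammaN : 2 * gamma_R e = 3 * gamma_r2 e.
  apply/eqP; rewrite -(Num.Theory.eqr_nat rat) !GRing.Theory.natrM gammaE.
  by apply/eqP; field.
have pair i j ij := @colour_support_roman_pair T e f i j ij f_dom.
have le12 := gamma_R_le_pair (pair _ _ c12).
have le21 := gamma_R_le_pair (pair _ _ c21).
have card1 := cardsID (colour_support f colour2) (colour_support f colour1).
have card2 := cardsID (colour_support f colour1) (colour_support f colour2).
rewrite -f_min rainbow_weight_support in gammaN.
rewrite setIC in card2.
(* Adding [le12] and [le21] bounds [2 * gamma_R e] by [3 * gamma_r2 e] minus twice the size of this
   intersection. *)
have disj : colour_support f colour1 :&: colour_support f colour2 = set0.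
  by apply: cards0_eq; lia.
rewrite disj cards0 in card1 card2.
(* Both bounds must now be equalities, so [2 * a + b = 2 * b + a] for the two sizes [a] and [b]. *)
have cardE i j : #|colour_support f i| = #|colour_support f j|.
  by case: (colourP i) => ->; case: (colourP j) => ->; lia.
have gamma_ge i : 3 * #|colour_support f i| <= gamma_R e.
  by rewrite (cardE i colour1); have := cardE colour1 colour2; lia.
have pairE i j : i != j -> roman_pair e (colour_support f i) (colour_support f j).
  by move=> ij v vi vj; apply: (pair i j ij) => //; rewrite inE negb_and vj orbT.
have other (i : 'I_2) : exists2 j, i != j & j != i.
  by case: (colourP i) => ->; [exists colour2 | exists colour1].
have closed i u :
    #|colour_support f i :&: (u |: nbhd e u)| <= 2.
  have [j ij ji] := other i.
  exact: (optimal_pair_closed_nbhd e_sym (pairE _ _ ji) (cardE i j)).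
rewrite !colour_class_support // colour_class_setT // cards0.
split; first by split; first exact: cardE.
split.
  move=> u w.
  exact: (optimal_pair_nonadjacent e_sym (pairE _ _ c12) (cardE _ _)).
split.
  move=> i; rewrite colour_class_support //; apply: max_degree_induced => u iu.
  have := closed i u.
  (* One of the two vertices allowed is [u] itself, which by irreflexivity is not its own
     neighbour. *)
  by rewrite setIUr (setIidPr _) ?sub1set // cardsU1 !inE e_irr andbF.
split=> i u; have [j ij ji] := other i; rewrite colour_class_support //.
  rewrite (colour_class_set0 f ij) in_setC in_setU negb_or => /andP[iu ju].
  have [w euw iw] := pairE _ _ ij u iu ju.
  apply/andP; split; first by apply/card_gt0P; exists w; rewrite in_setI inE euw.
  apply: leq_trans (closed i u); rewrite setIC.
  by apply/subset_leq_card/setIS/subsetUr.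
rewrite (colour_class_set0 f ij) -setDE.
exact: (optimal_pair_private_nbhd e_sym (pairE _ _ ij) (pairE _ _ ji) (cardE i j)).
Qed.
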